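(* Let $n$ and $N$ be positive integers, let $\mathbb{F}\subset\mathbb{C}$ be a field, and let $p_1,\dots,p_n,q_1,\dots,q_n$ be positive integers such that (i) $p_1<\dots<p_n$; (ii) $p_i+q_i=N$ for all $i=1,\dots,n$; (iii) $p_i\neq q_j$ for all $i,j\in\{1,\dots,n\}$ with $i\neq j$; and furthermore $q_i<\frac N2$ for all $i=1,\dots,n$. Suppose that $f_1,\dots,f_n,g_1,\dots,g_n\colon\mathbb{F}\to\mathbb{C}$ are additive functions, none of them identically zero, satisfying \[ \sum_{i=1}^{n} f_i(x^{p_i})\,g_i(x)^{q_i}=0\qquad\text{for every }x\in\mathbb{F}. \] Then there exist a positive integer $l$, exponentials $m_i\colon\mathbb{F}^{\times}\to\mathbb{C}$ and generalized polynomials $P_i,Q_i\colon\mathbb{F}^{\times}\to\mathbb{C}$ of degree at most $l$ ($i=1,\dots,n$) such that \[ f_i(x)=P_i(x)m_i(x)\quad\text{and}\quad g_i(x)=Q_i(x)m_i(x)\qquad(x\in\mathbb{F}^{\times}) \] for each $i=1,\dots,n$.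
   Context: A function $f\colon\mathbb{F}\to\mathbb{C}$ is additive if $f(x+y)=f(x)+f(y)$ for all $x,y\in\mathbb{F}$. $\mathbb{F}^\times$ is the multiplicative group of $\mathbb{F}$. An exponential on a commutative group $G$ (written multiplicatively) is a function $m\colon G\to\mathbb{C}$ with $m(xy)=m(x)m(y)$ for all $x,y\in G$. A generalized polynomial of degree at most $l$ on $G$ is a function $p\colon G\to\mathbb{C}$ of the form $p(x)=\sum_{k=0}^{l}A_k(x,\dots,x)$ where each $A_k\colon G^k\to\mathbb{C}$ is symmetric and a homomorphism from $G$ to $(\mathbb{C},+)$ in each variable ($A_0$ is a constant). *)

(* Defs.v *)
From HB Require Import structures.
From mathcomp Require Import all_boot all_order all_algebra all_fingroup.
From mathcomp Require Import reals.
From mathcomp.real_closed Require Import complex.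

Set Implicit Arguments.
Unset Strict Implicit.
Unset Printing Implicit Defensive.

Import GRing.Theory.

Local Open Scope ring_scope.

Definition fmul (F : fieldType) := {x : F | x != 0}.

HB.instance Definition _ (F : fieldType) := SubChoice.on (fmul F).

Section FmulGroup.
Variable F : fieldType.
Implicit Types x y z : fmul F.

Definition fmul_mul x y : fmul F :=
  exist _ (val x * val y) (mulf_neq0 (valP x) (valP y)).

Definition fmul_one : fmul F := exist _ 1 (oner_neq0 F).

Definition fmul_inv x : fmul F :=
  exist _ (val x)^-1 (invr_neq0 (valP x)).

Lemma fmul_mulA : associative fmul_mul.
Proof. by move=> x y z; apply: val_inj; rewrite /= mulrA. Qed.

Lemma fmul_mulC : commutative fmul_mul.
Proof. by move=> x y; apply: val_inj; rewrite /= mulrC. Qed.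

Lemma fmul_mul1 : left_id fmul_one fmul_mul.
Proof. by move=> x; apply: val_inj; rewrite /= mul1r. Qed.

Lemma fmul_mulV : left_inverse fmul_one fmul_inv fmul_mul.
Proof. by move=> x; apply: val_inj; rewrite /= mulVf // (valP x). Qed.

Lemma fmul_mul1r : right_id fmul_one fmul_mul.
Proof. by move=> x; rewrite fmul_mulC fmul_mul1. Qed.

Lemma fmul_mulVr : right_inverse fmul_one fmul_inv fmul_mul.
Proof. by move=> x; rewrite fmul_mulC fmul_mulV. Qed.

HB.instance Definition _ := isGroup.Build (fmul F)
  fmul_mulA fmul_mul1 fmul_mul1r fmul_mulV fmul_mulVr.

End FmulGroup.

Notation "F ^*m" := (fmul F) (at level 2, format "F ^*m") : type_scope.

(* G is meant to be commutative; the definitions below do not depend on it. *)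
Section GroupFunctions.
Variables (C : comNzRingType) (G : groupType).

(* The identically zero function is allowed. *)
Definition exponential (m : G -> C) : Prop :=
  forall x y : G, m (x * y)%g = m x * m y.

Definition symmetric_fun (k : nat) (A : {ffun 'I_k -> G} -> C) : Prop :=
  forall (s : 'S_k) (v : {ffun 'I_k -> G}), A [ffun i => v (s i)] = A v.

Definition multiadditive (k : nat) (A : {ffun 'I_k -> G} -> C) : Prop :=
  forall (j : 'I_k) (v : {ffun 'I_k -> G}) (x y : G),
    let subst z := [ffun i => if i == j then z else v i] in
    A (subst (x * y)%g) = A (subst x) + A (subst y).

(* A k is a function of k variables; A 0 is a function on a one-point set,
   i.e. an arbitrary constant. *)
Definition generalized_polynomial (l : nat) (p : G -> C) : Prop :=
  exists A : forall k : nat, {ffun 'I_k -> G} -> C,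
    (forall k : nat, (k <= l)%N ->
       symmetric_fun (A k) /\ multiadditive (A k)) /\
    (forall x : G, p x = \sum_(k < l.+1) A k [ffun=> x]).

End GroupFunctions.

(* Main.v *)
Require Import Defs.
From HB Require Import structures.
From mathcomp Require Import all_boot all_order all_algebra all_fingroup.
From mathcomp Require Import boolp reals zify ring.
From mathcomp.real_closed Require Import complex.
From mathcomp.multinomials Require monalg.

Set Implicit Arguments.
Unset Strict Implicit.
Unset Printing Implicit Defensive.

Import GRing.Theory Num.Theory.

Local Open Scope ring_scope.

(* Extend f_i, g_i to linear functionals on the algebra A = C (x) F, where the
   equation still holds because a polynomial vanishing on N vanishes. Write
   ann h for the largest ideal in the kernel of a functional h.

   1. A / ann f_i is algebraic of bounded degree, by descending induction on i.
      Differentiating the equation at w + t c with g_j(w) = 0 for all j and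
      comparing powers of t shows that b |-> f_k(w^(p_k-1) b) lies in the span
      of the n functionals g_j, provided that w^(p_k-1) is in ann f_i for i > k.
      For given a, n + 1 such w in C[a] yield a T with T(a) in ann f_k.
   2. If uv is in every ann f_i, the coefficient of t^(p_k) in the equation at
      v + t u gives f_k(u^(p_k)) g_k(v) = 0; this is where q_i < N/2 enters.
      Applied to coprime factors of T, it leaves a single eigenvalue m_k(a) with
      a - m_k(a) nilpotent of bounded order modulo both ann f_k and ann g_k.
   3. Then m_k is multiplicative, and x / m_k(x) = exp(log(x / m_k(x))) with
      additive nilpotent log expresses f_k / m_k and g_k / m_k as generalized
      polynomials. *)

(** * Linear algebra and polynomial coefficients *)

Lemma exists_row_ker (K : fieldType) n (B : 'M[K]_(n.+1, n)) :
  exists2 c : 'rV[K]_n.+1, c != 0 & c *m B = 0.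
Proof.
have /rowV0Pn[c /sub_kermxP cB c0] : kermx B != 0.
  by rewrite kermx_eq0 -row_leq_rank -ltnNge ltnS rank_leq_col.
by exists c.
Qed.

(** Among the indices with nonzero coefficient, the polynomial of largest size has a leading term
    that no other one can cancel. *)
Lemma sum_scale_distinct_size (K : idomainType) m (G : 'I_m -> {poly K})
    (c : 'I_m -> K) :
  (forall j, G j != 0) -> injective (fun j => size (G j)) ->
  (exists j, c j != 0) -> \sum_j c j *: G j != 0.
Proof.
move=> G0 Ginj [j0 cj0].
pose sG j := size (G j).
case: (@arg_maxnP _ j0 (fun j => c j != 0) sG cj0) => j cj max.
apply/negP => /eqP/(congr1 (fun P : {poly K} => P`_(size (G j)).-1)).
rewrite coef0 coef_sum (bigD1 j) //= coefZ big1 ?addr0 => [/eqP|i ij].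
  by rewrite mulf_eq0 (negPf cj) /= lead_coef_eq0 (negPf (G0 j)).
rewrite coefZ; have [->|ci] := eqVneq (c i) 0; first by rewrite mul0r.
rewrite nth_default ?mulr0 // -ltnS prednK ?size_poly_gt0 //.
rewrite ltn_neqAle (max i ci : (_ <= _)%N) andbT.
by apply: contra ij => /eqP/Ginj ->.
Qed.

(** Turns identities valid along a line with parameter [t] into polynomial identities, whose
    coefficients can be compared. *)
Lemma nat_roots_eq0 (K : numDomainType) (Q : {poly K}) :
  (forall n : nat, Q.[n%:R] = 0) -> Q = 0.
Proof.
move=> Q0; apply: (@roots_geq_poly_eq0 _ _ [seq i%:R | i <- iota 0 (size Q)]).
- by apply/allP => _ /mapP[i _ ->]; rewrite /root Q0.
- by rewrite map_inj_uniq ?iota_uniq // => i j /eqP; rewrite eqr_nat => /eqP.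
- by rewrite size_map size_iota.
Qed.

Lemma coef_binomial_exp (A : comNzRingType) (w c : A) m j :
  ((w%:P + c%:P * 'X) ^+ m)`_j = w ^+ (m - j) * c ^+ j *+ 'C(m, j).
Proof.
rewrite exprDn coef_sum.
pose M := w ^+ (m - j) * c ^+ j *+ 'C(m, j).
transitivity (\sum_(i < m.+1) (if i == j :> nat then M else 0)).
  apply: eq_bigr => i _; rewrite coefMn exprMn -!rmorphXn /= mulrA -polyCM.
  rewrite coefMXn {}/M.
  case: ltngtP => [ij|ij|->].
  - by rewrite mul0rn.
  - by rewrite coefC subn_eq0 leqNgt ij mul0rn.
  - by rewrite coefC subnn.
have [jm|jm] := ltnP j m.+1.
  by rewrite -big_mkcond (big_pred1 (Ordinal jm)).
rewrite bin_small // mulr0n big1 // => i _.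
by rewrite ltn_eqF // (leq_trans (ltn_ord i)).
Qed.

(** * Annihilators of linear functionals *)

Section Functionals.
Variables (C : numClosedFieldType) (A : comAlgType C).
Implicit Types (h : {scalar A}) (a b d : A) (P : {poly A}) (T U : {poly C}).

Definition ann (h : A -> C) (d : A) : Prop := forall b, h (d * b) = 0.

Lemma ann0 h : ann h 0.
Proof. by move=> b; rewrite mul0r raddf0. Qed.

Lemma annD h a b : ann h a -> ann h b -> ann h (a + b).
Proof. by move=> ha hb c; rewrite mulrDl raddfD /= ha hb addr0. Qed.

Lemma annN h a : ann h a -> ann h (- a).
Proof. by move=> ha c; rewrite mulNr raddfN /= ha oppr0. Qed.

Lemma annMr h a b : ann h a -> ann h (a * b).
Proof. by move=> ha c; rewrite -mulrA. Qed.

Lemma annMl h a b : ann h a -> ann h (b * a).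
Proof. by rewrite mulrC; exact: annMr. Qed.

Lemma annZ h (c : C) a : ann h a -> ann h (c *: a).
Proof. by move=> ha; rewrite -mulr_algl; exact: annMl. Qed.

Lemma ann_sum h (I : Type) (r : seq I) (Q : pred I) (F : I -> A) :
  (forall i, Q i -> ann h (F i)) -> ann h (\sum_(i <- r | Q i) F i).
Proof. by move=> hF; elim/big_ind: _ => //; [exact: ann0|exact: annD]. Qed.

Lemma annX_leq h a m k : (m <= k)%N -> ann h (a ^+ m) -> ann h (a ^+ k).
Proof. by move=> /subnK <- ha; rewrite exprD; exact: annMl. Qed.

Lemma ann1_eq0 h : ann h 1 -> forall a, h a = 0.
Proof. by move=> h1 a; rewrite -[a]mul1r h1. Qed.

Lemma horner_scalar h P (t : C) : h P.[t%:A] = (map_poly h P).[t].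
Proof.
rewrite horner_coef (@horner_coef_wide _ (size P)) ?size_poly // raddf_sum /=.
apply: eq_bigr => i _; rewrite coef_map /=.
by rewrite -(rmorphXn (in_alg A)) /= mulr_algr linearZ /= mulrC.
Qed.

Lemma horner_scalar_nat h P (n : nat) : h P.[n%:R] = (map_poly h P).[n%:R].
Proof. by rewrite -horner_scalar scaler_nat. Qed.

(** A nonzero polynomial of least size annihilating [a] modulo [ann h] divides all others. It is not
    constant, because [h] is not zero, so it has a root in [C]. *)
Lemma ann_exists_root h a T :
  (exists x, h x != 0) -> T != 0 -> ann h (horner_alg a T) ->
  exists lam, forall U, ann h (horner_alg a U) -> root U lam.
Proof.
move=> [x hx] T0 hT.
have ex : exists m, `[< exists U,
    [/\ U != 0, ann h (horner_alg a U) & size U = m] >].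
  by exists (size T); apply/asboolP; exists T.
case: (ex_minnP ex) => m /asboolP[U [U0 hU sU]] min.
have /closed_rootP[lam Ulam] : size U != 1.
  apply/negP => /size_poly1P[c c0 Uc]; case/negP: hx; apply/eqP.
  apply: ann1_eq0; have := annZ c^-1 hU.
  by rewrite Uc horner_algC scalerA mulVf // scale1r.
exists lam => V hV.
suff : U %| V by move/dvdpP => [W ->]; rewrite rootM Ulam orbT.
apply: contraT => VU.
have : (size U <= size (V %% U)%R)%N.
  rewrite sU; apply: min; apply/asboolP; exists (V %% U); split=> //.
  have -> : V %% U = V - V %/ U * U by rewrite {2}(divp_eq V U) addrC addKr.
  by rewrite rmorphB rmorphM; apply: annD => //; apply: annN; exact: annMl.
by rewrite leqNgt ltn_modp U0.
Qed.

(** * Consequences of the equation on the algebra *)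

Section Equation.
Variables (n : nat) (p q : 'I_n -> nat) (f g : 'I_n -> {scalar A}).
Hypothesis p_gt_q : forall i j, (q i < p j)%N.
Hypothesis q_gt0 : forall i, (0 < q i)%N.
Hypothesis p_incr : forall i j : 'I_n, (i < j)%N -> (p i < p j)%N.
Hypothesis pqE : forall i j, (p i + q i = p j + q j)%N.
Hypothesis f_neq0 : forall i, exists x, f i x != 0.
Hypothesis g_neq0 : forall i, exists x, g i x != 0.
Hypothesis eq0 : forall a, \sum_i f i (a ^+ p i) * g i a ^+ q i = 0.

Lemma eq0_poly P :
  \sum_i map_poly (f i) (P ^+ p i) * map_poly (g i) P ^+ q i = 0.
Proof.
apply: nat_roots_eq0 => t; rewrite -[RHS](eq0 P.[t%:R]) horner_sum.
apply: eq_bigr => i _.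
by rewrite hornerM horner_exp -!horner_scalar_nat horner_exp.
Qed.

(** The derivative at [t = 0] of the equation at [u + t y]. *)
Lemma eq0_deriv (u y : A) :
  \sum_i (f i (u ^+ (p i).-1 * y) *+ p i * g i u ^+ q i
          + f i (u ^+ p i) * (g i u ^+ (q i).-1 *+ q i) * g i y) = 0.
Proof.
have := eq0_poly (u%:P + y%:P * 'X).
move/(congr1 (fun Q : {poly C} => Q^`().[0])).
rewrite deriv0 horner0 raddf_sum horner_sum /= => E; rewrite -[RHS]E.
have hor0 (h : {scalar A}) P : (map_poly h P).[0] = h P.[0].
  by rewrite -horner_scalar scale0r.
have derh (h : {scalar A}) P : (map_poly h P)^`() = map_poly h P^`().
  by apply/polyP => j; rewrite coef_deriv !coef_map coef_deriv raddfMn.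
have U0 : (u%:P + y%:P * 'X).[0] = u by rewrite !hornerE.
have U'0 : (u%:P + y%:P * 'X)^`() = y%:P.
  by rewrite derivD derivM !derivC derivX mul0r mulr1 !add0r.
apply: eq_bigr => i _.
rewrite derivM deriv_exp !derh deriv_exp U'0.
rewrite hornerD !hornerM hornerMn hornerM !horner_exp !hor0 hornerMn hornerM.
rewrite !horner_exp U0 !hornerC.
rewrite raddfMn /= (mulrC y) -[in LHS]mulrA mulrnAl.
by rewrite [in LHS](mulrC _ (g i y)).
Qed.

(* Compare the coefficients of t ^ q k in eq0_deriv at u = w + t c, where
   g k c != 0. *)
Lemma scale_f_in_span_g (w : A) (k : 'I_n) :
  (forall i, g i w = 0) ->
  (forall i : 'I_n, (k < i)%N -> ann (f i) (w ^+ (p k).-1)) ->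
  exists mu : 'I_n -> C,
    forall y, f k (w ^+ (p k).-1 * y) = \sum_i mu i * g i y.
Proof.
move=> gw fw; have [c gc] := g_neq0 k.
pose U := w%:P + c%:P * 'X.
have gU i : map_poly (g i) U = (g i c)%:P * 'X.
  apply/polyP => j; rewrite coef_map coefD coefC coefCM coefX coefCM coefX.
  by case: j => [|[|j]]; rewrite /= ?mulr0 ?mulr1 ?addr0 ?add0r ?gw ?raddf0.
pose nu i : {poly C} :=
  map_poly (f i) (U ^+ p i) * (map_poly (g i) U ^+ (q i).-1 *+ q i).
pose S (y : A) i : {poly C} :=
  map_poly (f i) (U ^+ (p i).-1 * y%:P) *+ p i * map_poly (g i) U ^+ q i.
have SE (y : A) : \sum_i (S y i + nu i * (g i y)%:P) = 0.
  apply: nat_roots_eq0 => t; rewrite -[RHS](eq0_deriv U.[t%:R] y) horner_sum.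
  apply: eq_bigr => i _; rewrite hornerD !hornerM !hornerMn !horner_exp hornerC.
  by rewrite -!horner_scalar_nat hornerM hornerC !horner_exp.
have pk : (p k)%:R != 0 :> C.
  by rewrite pnatr_eq0 -lt0n (leq_ltn_trans _ (p_gt_q k k)).
exists (fun i => - (nu i)`_(q k) / ((p k)%:R * g k c ^+ q k)) => y.
have := congr1 (fun Q : {poly C} => Q`_(q k)) (SE y).
rewrite coef0 coef_sum.
under eq_bigr do rewrite coefD.
rewrite big_split /= (bigD1 k) //= [X in _ + X + _]big1 ?addr0.
  have -> : (S y k)`_(q k) =
      f k (w ^+ (p k).-1 * y) * ((p k)%:R * g k c ^+ q k).
    rewrite /S gU exprMn [in LHS]mulrA coefMXn ltnn subnn -rmorphXn.
    rewrite coefMC coefMn.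
    rewrite coef_map /= coefMC coef_binomial_exp subn0 mulr1 bin0 mulr1n.
    by rewrite -[X in X * _]mulr_natr mulrA.
  move/eqP; rewrite addr_eq0 => /eqP E.
  apply: (@mulIf _ ((p k)%:R * g k c ^+ q k)).
    by rewrite mulf_neq0 ?expf_neq0.
  rewrite E mulr_suml -sumrN; apply: eq_bigr => i _.
  by rewrite coefMC mulrAC divfK ?mulNr // mulf_neq0 ?expf_neq0.
(* For [i] other than [k]: if [q k < q i], there is no term in [t ^ q k]. Otherwise [k < i], and
   since [p i - p k = q k - q i] the coefficient carries the factor [w ^+ (p k).-1], which lies in
   [ann (f i)]. *)
move=> i ik; rewrite /S gU exprMn mulrA coefMXn; case: ltnP => // qik.
rewrite -rmorphXn coefMC coefMn coef_map /= coefMC coef_binomial_exp.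
have ki : (k < i)%N.
  rewrite ltnNge leq_eqVlt; apply/negP => /orP[/eqP/val_inj ik'|/p_incr pik].
    by rewrite ik' eqxx in ik.
  by have := pqE i k; lia.
have -> : ((p i).-1 - (q k - q i) = (p k).-1)%N.
  by have := pqE i k; have := p_gt_q i i; have := p_gt_q k k; lia.
by rewrite -mulrnAr -mulrA (fw i ki) mul0rn mul0r.
Qed.


(* The bounds on size U make the sizes for different j distinct, so that no
   nontrivial combination of the polynomials U ^+ (p k).-1 vanishes. *)
Lemma exists_multiple_in_span_g (k : 'I_n) a T :
  T != 0 -> (forall i : 'I_n, (k < i)%N -> ann (f i) (horner_alg a T)) ->
  forall j : nat, exists U, [/\ U != 0,
    ((size T).-1 + j * n.+1 < size U <= (size T).-1 + j * n.+1 + n.+1)%N &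
    (exists V, U = T * V) /\
    exists mu : 'I_n -> C, forall y,
      f k (horner_alg a (U ^+ (p k).-1) * y) = \sum_i mu i * g i y].
Proof.
move=> T0 Tann j.
(* There are [n.+1] free coefficients against the [n] conditions that each [g i] vanish at [U]
   evaluated in [a]. *)
have [c c0 cB] := exists_row_ker (\matrix_(s < n.+1, i < n)
  g i (horner_alg a (T * 'X^(j * n.+1 + s)))).
have r0 : rVpoly c != 0 by rewrite raddf_eq0 //; exact: can_inj (@rVpolyK _ _).
pose U := T * ('X^(j * n.+1) * rVpoly c).
have X0 : 'X^(j * n.+1) != 0 :> {poly C} by rewrite monic_neq0 ?monicXn.
have sU : (size U = (size T).-1 + j * n.+1 + size (rVpoly c))%N.
  rewrite size_mul ?mulf_neq0 // size_mul // size_polyXn.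
  have sT : (0 < size T)%N by rewrite size_poly_gt0.
  by move: sT; move: (j * n.+1)%N (size T) (size (rVpoly c)) => e s r; lia.
have gU i : g i (horner_alg a U) = 0.
  have /rowP/(_ i) := cB; rewrite !mxE => <-.
  rewrite /U /rVpoly poly_def !mulr_sumr !raddf_sum /=.
  apply: eq_bigr => s _; rewrite mxE insubT //= => sn.
  rewrite -!scalerAr -exprD. rewrite linearZ /= mulr_algl linearZ.
  by congr (c _ _ * _); exact: val_inj.
exists U; split.
- by rewrite !mulf_neq0.
- rewrite sU -[X in (X < _)%N]addn0 ltn_add2l size_poly_gt0 r0 leq_add2l.
  exact: size_poly.
- split; first by eexists.
  rewrite rmorphXn; apply: scale_f_in_span_g => // i ki.
  have pk : (0 < (p k).-1)%N by have := p_gt_q k k; have := q_gt0 k; lia.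
  by rewrite -(prednK pk) exprS rmorphM; do 2! apply: annMr; exact: Tann.
Qed.

(** Here [m] counts the last indices already treated; the step adds [k = n - m.+1]. That [M] is
    independent of [a] later makes the nilpotency order uniform. *)
Lemma f_algebraic m : (m <= n)%N ->
  exists M, forall a, exists T, [/\ T != 0, (size T <= M)%N &
    forall i : 'I_n, (n - m <= i)%N -> ann (f i) (horner_alg a T)].
Proof.
elim: m => [_|m IH mn].
  exists 1%N => a; exists 1; rewrite oner_eq0 size_poly1; split=> // i.
  by rewrite subn0 leqNgt ltn_ord.
have [M HM] := IH (ltnW mn).
have kP : (n - m.+1 < n)%N by lia.
pose k := Ordinal kP.
exists ((M + n.+1 * n.+1 + n.+1) * (p k).-1).+1 => a.
have [T [T0 sT Tann]] := HM a.
have Tann' (i : 'I_n) : (k < i)%N -> ann (f i) (horner_alg a T).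
  by move=> ki; apply: Tann; move: ki; rewrite /=; lia.
have /fin_all_exists[U HU] : forall j : 'I_n.+1, exists U, _ :=
  fun j => exists_multiple_in_span_g T0 Tann' j.
have /fin_all_exists[mu Hmu] : forall j : 'I_n.+1, exists mu : 'I_n -> C,
    forall y, f k (horner_alg a (U j ^+ (p k).-1) * y) = \sum_i mu i * g i y.
  by move=> j; have [_ _ []] := HU j.
(* The [n.+1] functionals attached to the [U j] lie in the span of the [n] functionals [g i], so a
   nontrivial combination of them vanishes. *)
have [c c0 cB] := exists_row_ker (\matrix_(j < n.+1, i < n) mu j i).
have pk : (0 < (p k).-1)%N by have := p_gt_q k k; have := q_gt0 k; lia.
have sU j : (size (U j ^+ (p k).-1) = ((size (U j)).-1 * (p k).-1).+1)%N.
  have [U0 _ _] := HU j; rewrite -size_exp prednK // size_poly_gt0.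
  by rewrite expf_neq0.
exists (\sum_j c 0 j *: U j ^+ (p k).-1); split.
- apply: sum_scale_distinct_size => [j|i j /=|].
  + by have [U0 _ _] := HU j; rewrite expf_neq0.
  + rewrite !sU => -[] /eqP; rewrite eqn_pmul2r // => /eqP E.
    have [_ /andP[i1 i2] _] := HU i; have [_ /andP[j1 j2] _] := HU j.
    have step (x y : nat) : (x < y)%N ->
        ((size T).-1 + x * n.+1 + n.+1 <= (size T).-1 + y * n.+1)%N.
      by move=> xy; rewrite -addnA leq_add2l -mulSnr leq_mul2r xy orbT.
    apply: val_inj => /=; case: (ltngtP i j) => // /step ij.
    + by have := leq_ltn_trans (leq_trans i2 ij) j1;
        move: (size _) (size _) E i1 j1 => *; lia.
    + by have := leq_ltn_trans (leq_trans j2 ij) i1;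
        move: (size _) (size _) E i1 j1 => *; lia.
  + apply/existsP; apply: contraNT c0 => /existsPn H; apply/eqP/rowP => j.
    by rewrite mxE; apply/eqP; rewrite -[_ == _]negbK.
- apply: (leq_trans (size_sum _ _ _)); apply/bigmax_leqP => j _.
  apply: (leq_trans (size_scale_leq _ _)); rewrite sU ltnS leq_mul2r.
  have [_ /andP[_ sUj] _] := HU j.
  have : (j * n.+1 <= n.+1 * n.+1)%N by rewrite leq_mul2r ltnW ?orbT.
  by apply/implyP; rewrite implybE orbCA; apply/orP; right; lia.
- move=> i; rewrite leq_eqVlt => /orP[/eqP ik|ki].
    have -> : i = k by apply: val_inj; rewrite /= -ik.
    move=> y; rewrite raddf_sum mulr_suml raddf_sum /=.
    under eq_bigr do
      rewrite linearZ /= mulr_algl -scalerAl linearZ /= Hmu mulr_sumr.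
    rewrite exchange_big big1 //= => s _.
    under eq_bigr do rewrite mulrA; rewrite -mulr_suml.
    have /rowP/(_ s) := cB; rewrite !mxE; under eq_bigr do rewrite mxE.
    by move=> ->; rewrite mul0r.
  (* For [i] above [k], annihilation persists because every [U j] is a multiple of [T]. *)
  rewrite raddf_sum /=; apply: ann_sum => j _.
  rewrite linearZ /= mulr_algl; apply: annZ.
  have [_ _ [[V ->] _]] := HU j.
  rewrite -(prednK pk) exprS rmorphM rmorphM /=; do 2! apply: annMr.
  by apply: Tann; lia.
Qed.

(* Compare the coefficients of t ^ p k in the equation at v + t u. *)
Lemma f_or_g_eq0 (u v : A) : (forall i, ann (f i) (u * v)) ->
  forall k, f k (u ^+ p k) * g k v = 0.
Proof.
move=> uv k; have [m] := ubnP (k : nat); elim: m k => // m IH k /ltnSE km.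
have p_gt0 i : (0 < p i)%N by exact: leq_ltn_trans (p_gt_q i i).
pose U := v%:P + u%:P * 'X.
have gU i : map_poly (g i) U = (g i v)%:P + (g i u)%:P * 'X.
  by apply/polyP => j; rewrite coef_map !coefD !coefCM !coefC !coefX;
     case: j => [|[|j]]; rewrite /= ?mulr0 ?mulr1 ?addr0 ?add0r ?raddf0.
(* Every mixed term of [(v + t u) ^ p i] contains [u * v]. *)
have fU i : map_poly (f i) (U ^+ p i) =
    (f i (v ^+ p i))%:P + (f i (u ^+ p i))%:P * 'X^(p i).
  apply/polyP => j; rewrite coef_map coef_binomial_exp coefD coefC coefMXn coefC.
  have [->|j0] := eqVneq j 0%N; first by rewrite p_gt0 subn0 mulr1 bin0 addr0.
  have [jp|pj|->] := ltngtP j (p i); first last.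
  - by rewrite subnn mul1r binn add0r.
  - by rewrite bin_small // subn_eq0 leqNgt pj addr0 raddf0.
  rewrite addr0 raddfMn /= -(prednK (_ : 0 < j)%N) ?lt0n // exprS.
  have : (0 < p i - j.-1.+1)%N by lia.
  move/prednK <-; rewrite exprS mulrACA (mulrC v u).
  by rewrite uv mul0rn.
have := congr1 (fun Q : {poly C} => Q`_(p k)) (eq0_poly U).
rewrite coef0 coef_sum (bigD1 k) //= big1 ?addr0.
  rewrite fU gU mulrDl coefD coefCM coef_binomial_exp bin_small //.
  rewrite mulr0n mulr0 add0r -mulrA -commr_polyXn mulrA coefMXn ltnn subnn.
  rewrite coefCM coef_binomial_exp subn0 mulr1 bin0 mulr1n => /eqP.
  rewrite mulf_eq0 expf_eq0 => fg0; apply/eqP; rewrite mulf_eq0.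
  by case/orP: fg0 => [->|/andP[_ ->]]; rewrite ?orbT.
(* The part with [v ^+ p i] has degree at most [q i < p k]. The other part contributes only for
   [i < k], where [g i v] occurs with exponent [q i - (p k - p i) = q k > 0]; the induction
   hypothesis kills it. *)
move=> i ik; rewrite fU gU mulrDl coefD coefCM coef_binomial_exp bin_small //.
rewrite mulr0n mulr0 add0r -mulrA -commr_polyXn mulrA coefMXn.
case: ltnP => // pik; rewrite coefCM coef_binomial_exp.
have ki : (i < k)%N.
  rewrite ltnNge leq_eqVlt; apply/negP => /orP[/eqP/val_inj ik'|/p_incr].
    by rewrite ik' eqxx in ik.
  by rewrite ltnNge pik.
have -> : (q i - (p k - p i))%N = (q k).-1.+1.
  by have := pqE i k; have := q_gt0 k; lia.
rewrite mulrnAr exprS -mulrA [X in X *+ _]mulrA IH ?(leq_trans ki) //.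
by rewrite mul0r mul0rn.
Qed.

(** If [g k (v * c) != 0], the previous lemma at [u * a] and [v * c] gives
    [f k ((u * a) ^+ p k) = 0] for all [a]. At [a = 1 + t b] the coefficient of [t] is [p k] times
    [f k (u ^+ p k * b)]. *)
Lemma ann_f_or_ann_g (u v : A) : (forall i, ann (f i) (u * v)) ->
  forall k, ann (f k) (u ^+ p k) \/ ann (g k) v.
Proof.
move=> uv k; have [[c gc]|gv] := pselect (exists c, g k (v * c) != 0); last first.
  by right=> b; apply: contrapT => /eqP gb; apply: gv; exists b.
left=> b.
have f0 a : f k ((u * a) ^+ p k) = 0.
  have /f_or_g_eq0/(_ k) : forall i, ann (f i) ((u * a) * (v * c)).
    by move=> i; rewrite mulrACA; exact: annMr.
  by move/eqP; rewrite mulf_eq0 (negPf gc) orbF => /eqP.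
have : map_poly (f k) ((u%:P + (u * b)%:P * 'X) ^+ p k) = 0.
  apply: nat_roots_eq0 => t; rewrite -horner_scalar_nat horner_exp !hornerE.
  by rewrite -mulrA -[X in X + _]mulr1 -mulrDr.
move/(congr1 (fun Q : {poly C} => Q`_1)); rewrite coef0 coef_map coef_binomial_exp.
have p_gt0 : (0 < p k)%N by exact: leq_ltn_trans (p_gt_q k k).
rewrite bin1 expr1 mulrA -exprSr subn1 prednK // raddfMn => /eqP.
by rewrite mulrn_eq0 -leqn0 leqNgt p_gt0 => /eqP.
Qed.

(** Splits [T] into a power of ['X - lam] and a cofactor [Q] nonzero at [lam], then applies the
    dichotomy to the two factors in both orders. *)
Lemma common_eigenvalue : exists L, forall a k, exists lam,
  ann (f k) ((a - lam%:A) ^+ L) /\ ann (g k) ((a - lam%:A) ^+ L).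
Proof.
have [M HM] := f_algebraic (leqnn n).
(* [M] bounds the multiplicity of [lam], and the sum dominates each [p k]. *)
exists (M * \sum_i p i)%N => a k.
have [T [T0 sT Tann]] := HM a.
have {}Tann i : ann (f i) (horner_alg a T) by apply: Tann; rewrite subnn.
have [lam flam] := ann_exists_root (f_neq0 k) T0 (Tann k).
have [m [Q]] := multiplicity_XsubC T lam; rewrite T0 /= => Qlam TE.
pose u := horner_alg a (('X - lam%:P) ^+ m); pose v := horner_alg a Q.
have uE : u = (a - lam%:A) ^+ m.
  by rewrite /u rmorphXn rmorphB /= horner_algX horner_algC.
have vu i : ann (f i) (v * u) by rewrite -rmorphM -TE.
(* Otherwise a power of [Q] would annihilate [f k], and [lam] would be a root of [Q]. *)
have gu : ann (g k) u.
  case: (ann_f_or_ann_g vu k) => // fv; case/negP: Qlam.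
  have : root (Q ^+ p k) lam by apply: flam; rewrite rmorphXn.
  by rewrite rootE horner_exp expf_eq0 => /andP[].
have gT : ann (g k) (horner_alg a T) by rewrite TE rmorphM; exact: annMl.
(* The eigenvalue for [g k] must equal [lam], which excludes [v] from [ann (g k)] in the second
   application. *)
have [mu gmu] := ann_exists_root (g_neq0 k) T0 gT.
have muE : mu = lam.
  have := gmu _ gu.
  by rewrite rootE horner_exp expf_eq0 hornerXsubC subr_eq0 => /andP[_ /eqP].
have fu : ann (f k) (u ^+ p k).
  have uv i : ann (f i) (u * v) by rewrite mulrC.
  by case: (ann_f_or_ann_g uv k) => // /gmu; rewrite muE (negPf Qlam).
have mM : (m <= M)%N.
  have Q0 : Q != 0 by apply: contraNneq Qlam => ->; rewrite root0.
  apply: leq_trans sT; rewrite TE size_mul ?expf_neq0 ?polyXsubC_eq0 //.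
  by rewrite size_exp_XsubC addnS leq_addl.
have pS : (p k <= \sum_i p i)%N by rewrite (bigD1 k) //= leq_addr.
have p_gt0 : (0 < p k)%N by exact: leq_ltn_trans (p_gt_q k k).
exists lam; split.
  by apply: (annX_leq (leq_mul mM pS)); rewrite exprM -uE.
apply: (@annX_leq _ _ m); last by rewrite -uE.
by rewrite (leq_trans mM) // leq_pmulr // (leq_trans p_gt0).
Qed.

End Equation.
End Functionals.

(** * Binomial coefficients as polynomials *)

Section BinomialPoly.
Variable K : numFieldType.

Definition binomial_poly k : {poly K} :=
  k`!%:R^-1 *: \prod_(j < k) ('X - j%:R%:P).

Lemma size_binomial_poly k : (size (binomial_poly k) <= k.+1)%N.
Proof.
apply: leq_trans (size_scale_leq _ _) _.
by rewrite size_prod_XsubC /index_enum -enumT size_enum_ord.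
Qed.

Lemma horner_binomial_poly k m : (binomial_poly k).[m%:R] = 'C(m, k)%:R.
Proof.
rewrite /binomial_poly hornerZ horner_prod.
have -> : \prod_(j < k) ('X - j%:R%:P).[m%:R] = (m ^_ k)%:R :> K.
  elim: k => [|k IH]; first by rewrite big_ord0.
  rewrite big_ord_recr IH /= hornerXsubC ffactnSr natrM.
  have [km|mk] := leqP k m; first by rewrite natrB.
  by rewrite ffact_small // !mul0r.
by rewrite -bin_ffact natrM mulrC mulfK // pnatr_eq0 -lt0n fact_gt0.
Qed.

End BinomialPoly.

(** * Congruence and nilpotency modulo an annihilator *)

Section Congruence.
Variables (C : numClosedFieldType) (A : comAlgType C) (h : {scalar A}).
Implicit Types (a b c d : A).

Definition cong a b : Prop := ann h (a - b).

Lemma cong_refl a : cong a a.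
Proof. by rewrite /cong subrr; exact: ann0. Qed.

Lemma cong_sym a b : cong a b -> cong b a.
Proof. by rewrite /cong -opprB => /annN; rewrite opprK. Qed.

Lemma cong_trans b a c : cong a b -> cong b c -> cong a c.
Proof. by rewrite /cong => ab bc; rewrite -(subrKA b); exact: annD. Qed.

Lemma congD a b c d : cong a b -> cong c d -> cong (a + c) (b + d).
Proof. by rewrite /cong => ab cd; rewrite opprD addrACA; exact: annD. Qed.

Lemma congM a b c d : cong a b -> cong c d -> cong (a * c) (b * d).
Proof.
rewrite /cong => ab cd; rewrite -(subrKA (b * c)) -mulrBl -mulrBr.
by apply: annD; [exact: annMr|exact: annMl].
Qed.

Lemma congMn a b k : cong a b -> cong (a *+ k) (b *+ k).
Proof. by rewrite /cong -mulrnBl -mulr_natr; exact: annMr. Qed.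

Lemma congX a b k : cong a b -> cong (a ^+ k) (b ^+ k).
Proof.
move=> ab; elim: k => [|k IH]; first exact: cong_refl.
by rewrite !exprS; exact: congM.
Qed.

Lemma cong_h a b : cong a b -> h a = h b.
Proof. by move=> /(_ 1); rewrite mulr1 raddfB => /eqP; rewrite subr_eq0 => /eqP. Qed.

Lemma ann_coef (Q : {poly A}) :
  (forall m : nat, ann h Q.[m%:R]) -> forall k, ann h Q`_k.
Proof.
move=> Q0 k b; have : map_poly h (Q * b%:P) = 0.
  by apply: nat_roots_eq0 => m; rewrite -horner_scalar_nat hornerM hornerC Q0.
by move/(congr1 (fun P : {poly C} => P`_k)); rewrite coef0 coef_map coefMC.
Qed.

Lemma cong_coef (Q P : {poly A}) :
  (forall m : nat, cong Q.[m%:R] P.[m%:R]) -> forall k, cong Q`_k P`_k.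
Proof.
move=> QP k; rewrite /cong -coefB; apply: ann_coef => m.
by rewrite hornerD hornerN; exact: QP.
Qed.

Definition nilp a : Prop := exists k, ann h (a ^+ k).

Lemma nilpD a b : nilp a -> nilp b -> nilp (a + b).
Proof.
move=> [k ak] [l bl]; exists (k + l)%N; rewrite exprDn; apply: ann_sum => i _.
rewrite -mulr_natr; apply: annMr.
have [il|li] := leqP i l.
  by apply: annMr; apply: annX_leq ak; lia.
by apply: annMl; apply: annX_leq bl; lia.
Qed.

Lemma nilpM a b : nilp a -> nilp (a * b).
Proof. by move=> [k ak]; exists k; rewrite exprMn; exact: annMr. Qed.

Lemma nilp_ann a : ann h a -> nilp a.
Proof. by exists 1%N. Qed.

Lemma nilpN a : nilp a -> nilp (- a).
Proof. by move=> na; rewrite -mulrN1; exact: nilpM. Qed.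

Hypothesis h_neq0 : exists x, h x != 0.

Lemma nilp_scalar (t : C) : nilp t%:A -> t = 0.
Proof.
move=> [k tk]; have [//|t0] := eqVneq t 0.
have [x hx] := h_neq0; case/negP: hx; apply/eqP; apply: ann1_eq0.
have := annZ (t ^- k) tk.
by rewrite -(rmorphXn (in_alg A)) /= scalerA mulVf ?expf_neq0 // scale1r.
Qed.

(** The difference of the two scalars is nilpotent, and a nonzero scalar is not, because [h] is not
    zero. *)
Lemma nilp_scalar_uniq a b (s t : C) :
  cong a b -> nilp (a - s%:A) -> nilp (b - t%:A) -> s = t.
Proof.
move=> /nilp_ann ab /nilpN as_ bt; apply/eqP; rewrite -subr_eq0; apply/eqP.
apply: nilp_scalar; have := nilpD ab (nilpD as_ bt).
by congr nilp; rewrite scalerBl; ring.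
Qed.

(** * Group elements with a single eigenvalue *)

Section OnGroup.
Variables (G : groupType) (iota : G -> A) (m : G -> C) (L : nat).
Hypothesis iota1 : cong (iota 1%g) 1.
Hypothesis iotaM : forall x y, cong (iota (x * y)%g) (iota x * iota y).
Hypothesis mP : forall x, ann h ((iota x - (m x)%:A) ^+ L).

(** Modulo the annihilator, [iota x * iota y] differs from the scalar [m x * m y] by a nilpotent
    element, and eigenvalues are unique. *)
Lemma eigenvalue_exponential : exponential m.
Proof.
move=> x y; apply: (nilp_scalar_uniq (iotaM x y)); first by exists L.
have -> : iota x * iota y - (m x * m y)%:A
    = (iota x - (m x)%:A) * iota y + (iota y - (m y)%:A) * (m x)%:A.
  rewrite !mulrBl [X in _ + (_ - X)](_ : _ = (m x * m y)%:A).
    by rewrite (mulrC (iota y)) addrA subrK.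
  by rewrite mulr_algr scalerA.
by apply: nilpD; apply: nilpM; exists L.
Qed.

Lemma eigenvalue_neq0 x : m x != 0.
Proof.
have m1 : m 1%g = 1.
  apply: (nilp_scalar_uniq iota1); first by exists L.
  by rewrite scale1r subrr; apply: nilp_ann; exact: ann0.
apply/eqP => mx; have := eigenvalue_exponential x x^-1%g.
by rewrite mulgV m1 mx mul0r => /eqP; rewrite oner_eq0.
Qed.

(** The unipotent part of [iota x]. *)
Let sigma x := (m x)^-1 *: iota x.

Let sigmaM x y : cong (sigma (x * y)%g) (sigma x * sigma y).
Proof.
rewrite /sigma eigenvalue_exponential invfM -scalerAl -scalerAr scalerA /cong.
by rewrite -scalerBr; apply: annZ; exact: iotaM.
Qed.

Let nu_nil x : ann h ((sigma x - 1) ^+ L).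
Proof.
have -> : sigma x - 1 = (m x)^-1 *: (iota x - (m x)%:A).
  by rewrite scalerBr scalerA mulVf ?eigenvalue_neq0 // scale1r.
by rewrite exprZn; exact: annZ.
Qed.

(* Interpolates the powers of sigma x; its coefficients are
   log (sigma x) ^+ k / k`! modulo the annihilator. *)
Let expo x : {poly A} :=
  \sum_(k < L) (sigma x - 1) ^+ k *: map_poly (in_alg A) (binomial_poly C k).

Let expoP x (s : nat) : cong (expo x).[s%:R] (sigma x ^+ s).
Proof.
pose F k := (sigma x - 1) ^+ k *+ 'C(s, k).
have -> : (expo x).[s%:R] = \sum_(k < L) F k.
  rewrite horner_sum; apply: eq_bigr => k _; rewrite hornerZ.
  rewrite -(rmorph_nat (in_alg A)) horner_map horner_binomial_poly rmorph_nat.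
  by rewrite mulr_natr.
(* A common longer range: binomial coefficients vanish beyond [s], and powers of [sigma x - 1] from
   exponent [L] on lie in the annihilator. *)
have -> : sigma x ^+ s = \sum_(k < s.+1 + L) F k.
  rewrite big_split_ord /= [X in _ + X]big1 ?addr0 => [|k _].
    by rewrite -{1}(subrK 1 (sigma x)) exprD1n.
  by rewrite /F bin_small ?mulr0n //= leq_addr.
rewrite addnC big_split_ord /= -[X in cong X]addr0.
apply: congD; first exact: cong_refl.
apply: cong_sym; rewrite /cong subr0; apply: ann_sum => k _.
by rewrite /F -mulr_natr; apply: annMr; apply: annX_leq (nu_nil x); exact: leq_addr.
Qed.

Let size_expo x : (size (expo x) <= L.+1)%N.
Proof.
apply: leq_trans (size_sum _ _ _) _; apply/bigmax_leqP => k _.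
apply: leq_trans (size_scale_leq _ _) _; apply: leq_trans (size_poly _ _) _.
by apply: leq_trans (size_binomial_poly _ _) _; rewrite ltnS ltnW.
Qed.

Let expo0 x : cong (expo x)`_0 1.
Proof. by rewrite -horner_coef0 -[0]/(0%:R) -[1](expr0 (sigma x)); exact: expoP. Qed.

(** Additivity of the logarithm: [expo (x * y)] and [expo x * expo y] agree at all naturals, so
    their linear coefficients agree; the constant coefficients are congruent to 1. *)
Let expo1M x y : cong (expo (x * y)%g)`_1 ((expo x)`_1 + (expo y)`_1).
Proof.
have E : cong (expo (x * y)%g)`_1 (expo x * expo y)`_1.
  apply: cong_coef => s; rewrite hornerM; apply: cong_trans (expoP _ _) _.
  apply: cong_trans (congX s (sigmaM x y)) _; rewrite exprMn.
  by apply: cong_sym; apply: congM; exact: expoP.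
apply: cong_trans E _; rewrite coefM !big_ord_recl big_ord0 addr0 addrC /=.
by apply: congD; [rewrite -[X in cong _ X]mulr1|rewrite -[X in cong _ X]mul1r];
  apply: congM => //; exact: cong_refl.
Qed.

(** The differential equation [E' = E'(0) E] of the exponential, read off from
    [E(s + t) = E(s) E(t)] by comparing the coefficients of [t]. *)
Let expoS x k : cong ((expo x)`_k.+1 *+ k.+1) ((expo x)`_1 * (expo x)`_k).
Proof.
rewrite -coef_deriv -coefCM.
apply: (@cong_coef (expo x)^`() (((expo x)`_1)%:P * expo x)) => s.
rewrite hornerM hornerC mulrC -coefCM.
have -> : (expo x)^`().[s%:R] = (expo x \Po ('X + s%:R%:P))`_1.
  rewrite -[RHS]mulr1n -[RHS]coef_deriv -horner_coef0 deriv_comp.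
  rewrite derivD derivX derivC addr0 mulr1 horner_comp.
  by rewrite hornerD hornerX hornerC add0r.
apply: cong_coef => t; rewrite horner_comp hornerM !hornerE -natrD.
apply: cong_trans (expoP _ _) _; rewrite addnC exprD.
by apply: cong_sym; apply: congM; exact: expoP.
Qed.

Let expo_fact x k : cong ((expo x)`_k *+ k`!) ((expo x)`_1 ^+ k).
Proof.
elim: k => [|k IH]; first by rewrite mulr1n; exact: expo0.
rewrite factS mulrnA exprS.
apply: (@cong_trans (((expo x)`_1 * (expo x)`_k) *+ k`!)).
  by apply: congMn; exact: expoS.
by rewrite -mulrnAr; apply: congM; [exact: cong_refl|exact: IH].
Qed.

(** [sigma x] is congruent to the value of [expo x] at 1, a sum of powers of the logarithm over
    [k!]. Additivity of the logarithm makes each term the diagonal of a symmetric multiadditive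
    function. *)
Lemma eigenvalue_generalized_polynomial :
  generalized_polynomial L (fun x => h (iota x) / m x).
Proof.
exists (fun k (v : {ffun 'I_k -> G}) =>
  k`!%:R^-1 * h (\prod_i (expo (v i))`_1)); split=> [k _|x].
  split=> [s v|j v x y] /=.
    congr (_ * h _); rewrite [RHS](reindex_inj (@perm_inj _ s)) /=.
    by apply: eq_bigr => i _; rewrite ffunE.
  rewrite -mulrDr; congr (_ * _).
  have E z : \prod_i (expo ([ffun i => if i == j then z else v i] i))`_1
      = (expo z)`_1 * \prod_(i | i != j) (expo (v i))`_1.
    rewrite (bigD1 j) //= ffunE eqxx; congr (_ * _).
    by apply: eq_bigr => i /negPf ij; rewrite ffunE ij.
  rewrite !E -raddfD -mulrDl; apply: cong_h; apply: congM; last exact: cong_refl.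
  exact: expo1M.
have -> : h (iota x) / m x = h (expo x).[1].
  rewrite mulrC -linearZ /= -/(sigma x) -[sigma x]expr1.
  by apply: cong_h; apply: cong_sym; exact: (expoP x 1).
rewrite (horner_coef_wide _ (size_expo x)) raddf_sum /=.
apply: eq_bigr => k _; rewrite expr1n mulr1.
under eq_bigr do rewrite ffunE.
rewrite prodr_const card_ord -(cong_h (expo_fact x k)) raddfMn /=.
by rewrite -[X in _ * X]mulr_natl mulKf // pnatr_eq0 -lt0n fact_gt0.
Qed.

End OnGroup.
End Congruence.

(* The monoid algebra of monalg needs a monoid without nontrivial units, hence
   the unit adjoined to the multiplicative monoid of F. *)
Definition adjoin_unit (F : Type) := option F.

(** * The monoid algebra of the field *)

Section MonoidAlgebra.
Import -(notations) monalg.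
Variable F : fieldType.

HB.instance Definition _ := Choice.on (adjoin_unit F).

Definition adjoin_unit_mul (x y : adjoin_unit F) : adjoin_unit F :=
  if x is Some a then if y is Some b then Some (a * b) else x else y.

Lemma adjoin_unit_mulA : associative adjoin_unit_mul.
Proof. by case=> [x|] [y|] [z|] //=; rewrite mulrA. Qed.

Lemma adjoin_unit_mul1 : left_id None adjoin_unit_mul.
Proof. by []. Qed.

Lemma adjoin_unit_mul1r : right_id None adjoin_unit_mul.
Proof. by case. Qed.

Lemma adjoin_unit_mul_eq1 x y :
  adjoin_unit_mul x y = None -> x = None /\ y = None.
Proof. by case: x y => [x|] [y|]. Qed.

Lemma adjoin_unit_mulC : commutative adjoin_unit_mul.
Proof. by case=> [x|] [y|] //=; rewrite mulrC. Qed.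

HB.instance Definition _ := Choice_isMonomialDef.Build (adjoin_unit F)
  adjoin_unit_mulA adjoin_unit_mul1 adjoin_unit_mul1r adjoin_unit_mul_eq1.
HB.instance Definition _ := MonomialDef_isConomialDef.Build (adjoin_unit F)
  adjoin_unit_mulC.

Definition adjoin_unit_val (x : adjoin_unit F) : F := odflt 1 x.

Lemma adjoin_unit_valM x y :
  adjoin_unit_val (mmul x y) = adjoin_unit_val x * adjoin_unit_val y.
Proof. by case: x y => [x|] [y|] //=; rewrite ?mulr1 ?mul1r. Qed.

Variable C : numClosedFieldType.

(** Stands in for the tensor product of [C] and [F]: the addition of [F] is forgotten and returns
    only modulo annihilators of lifted additive functions. *)
Definition malgF : comAlgType C := malg (adjoin_unit F) C.

Definition munit (k : adjoin_unit F) : malgF := mkmalgU k 1.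

Definition iota (x : F) : malgF := munit (Some x).

Definition lift (f : F -> C) : malgF -> C :=
  mmap idfun (fun k => f (adjoin_unit_val k)).

HB.instance Definition _ (f : F -> C) := GRing.Additive.on (lift f).

Lemma lift_is_scalable (f : F -> C) : scalable_for *%R (lift f).
Proof.
move=> c a; rewrite /lift (mmapEw (msuppZ_le _ _)) mmapE big_distrr /=.
by apply: eq_bigr => k _; rewrite mcoeffZ mulrA.
Qed.

HB.instance Definition _ (f : F -> C) :=
  GRing.isScalable.Build C malgF C *%R (lift f) (lift_is_scalable f).

Lemma lift_munit f k : lift f (munit k) = f (adjoin_unit_val k).
Proof. by rewrite /lift /munit mmapU mul1r. Qed.

Lemma munitM k l : munit k * munit l = munit (mmul k l).
Proof. by rewrite /munit malgM_def fgmulUU mulr1. Qed.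

Lemma malgF_sum (a : malgF) :
  exists (s : seq (adjoin_unit F)) (c : adjoin_unit F -> C),
  a = \sum_(k <- s) c k *: munit k.
Proof.
exists (finmap.enum_fset (msupp a)), (fun k => mcoeff k a).
rewrite {1}(monalgE a).
apply: eq_bigr => k _; apply/malgP => l.
by rewrite mcoeffZ !mcoeffU mulr_natr.
Qed.

End MonoidAlgebra.

(** * Lifting additive functions and the equation *)

Section Lift.
Variables (F : fieldType) (C : numClosedFieldType).
Implicit Types (f : F -> C) (a b : malgF F C) (x y z : F).
Local Notation iota := (iota C).

Lemma lift_iota f x : lift f (iota x) = f x.
Proof. exact: lift_munit. Qed.

Lemma iotaM x y : iota (x * y) = iota x * iota y.
Proof. by rewrite /iota munitM. Qed.

Lemma iotaX x k : (0 < k)%N -> iota (x ^+ k) = iota x ^+ k.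
Proof.
case: k => // k _; elim: k => // k IH.
by rewrite exprS iotaM IH -exprS.
Qed.

Lemma ann_liftP f a : (forall k, lift f (a * munit C k) = 0) -> ann (lift f) a.
Proof.
move=> fa b; have [s [c ->]] := malgF_sum b.
rewrite mulr_sumr raddf_sum big1 //= => k _.
by rewrite -scalerAr linearZ /= fa mulr0.
Qed.

Section Additive.
Variable f : F -> C.
Hypothesis f_add : forall x y, f (x + y) = f x + f y.

Lemma cong_iotaD x y : cong (lift f) (iota (x + y)) (iota x + iota y).
Proof.
apply: ann_liftP => k; rewrite mulrBl mulrDl raddfB raddfD /= !munitM.
by rewrite !lift_munit !adjoin_unit_valM /= mulrDl f_add subrr.
Qed.

Lemma cong_munit k : cong (lift f) (munit C k) (iota (adjoin_unit_val k)).
Proof.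
apply: ann_liftP => l; rewrite mulrBl raddfB /= !munitM.
by rewrite !lift_munit !adjoin_unit_valM subrr.
Qed.

(** The unit of the algebra is the adjoined one, so [iota 1] agrees with it only modulo the
    annihilator. *)
Lemma cong_iota1 : cong (lift f) (iota 1) 1.
Proof. exact: cong_sym (cong_munit None). Qed.

Lemma cong_iotaDn z k (t : nat) :
  cong (lift f) (iota (z + adjoin_unit_val k *+ t)) (iota z + munit C k *+ t).
Proof.
elim: t => [|t IH]; first by rewrite !mulr0n !addr0; exact: cong_refl.
rewrite !mulrSr !addrA; apply: cong_trans (cong_iotaD _ _) _.
by apply: congD => //; apply: cong_sym; exact: cong_munit.
Qed.

Lemma cong_iota0D a : cong (lift f) a (iota 0 + a).
Proof.
rewrite -[X in cong _ X]add0r; apply: congD; last exact: cong_refl.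
have := congD (cong_iotaD 0 0) (cong_refl (lift f) (- iota 0)).
by rewrite addr0 subrr addrK.
Qed.

End Additive.

Lemma lift_equation n (p q : 'I_n -> nat) (f g : 'I_n -> F -> C) :
  (forall i, (0 < p i)%N) ->
  (forall i x y, f i (x + y) = f i x + f i y) ->
  (forall i x y, g i (x + y) = g i x + g i y) ->
  (forall x, \sum_i f i (x ^+ p i) * g i x ^+ q i = 0) ->
  forall a, \sum_i lift (f i) (a ^+ p i) * lift (g i) a ^+ q i = 0.
Proof.
move=> p_gt0 f_add g_add eq0.
pose E a := \sum_i lift (f i) (a ^+ p i) * lift (g i) a ^+ q i.
(* [E] sees its argument only modulo the annihilators of lifted additive functions. *)
have E_cong a b : (forall h : F -> C, (forall x y, h (x + y) = h x + h y) ->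
    cong (lift h) a b) -> E a = E b.
  move=> ab; apply: eq_bigr => i _.
  by rewrite (cong_h (congX (p i) (ab _ (f_add i)))) (cong_h (ab _ (g_add i))).
(* The extra term [iota z], congruent to 0 at [z = 0], is there to absorb natural multiples of basis
   elements during the induction. *)
suff H s (c : adjoin_unit F -> C) z :
    E (iota z + \sum_(k <- s) c k *: munit C k) = 0.
  move=> a; have [s [c ac]] := malgF_sum a.
  rewrite -/(E a) (E_cong _ (iota 0 + a)); first by rewrite ac H.
  by move=> h h_add; exact: cong_iota0D.
elim: s z => [|k s IH] z.
  rewrite big_nil addr0 -[RHS](eq0 z); apply: eq_bigr => i _.
  by rewrite -iotaX ?p_gt0 // !lift_iota.
pose P : {poly malgF F C} :=
  (iota z + \sum_(k <- s) c k *: munit C k)%:P + (munit C k)%:P * 'X.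
pose Q : {poly C} :=
  \sum_i map_poly (lift (f i)) (P ^+ p i) * map_poly (lift (g i)) P ^+ q i.
have QE (t : C) : Q.[t] = E P.[t%:A].
  rewrite horner_sum; apply: eq_bigr => i _.
  by rewrite hornerM horner_exp -!horner_scalar horner_exp.
have Q0 : Q = 0.
  (* For natural [t], adding [t] times the new basis element only changes [z], so the induction
     hypothesis applies. The vanishing of [Q] then covers the scalar [c k]. *)
  apply: nat_roots_eq0 => t; rewrite QE -[RHS](IH (z + adjoin_unit_val k *+ t)).
  apply: E_cong => h h_add; rewrite !hornerE scaler_nat mulr_natr addrAC.
  apply: congD; last exact: cong_refl.
  by apply: cong_sym; exact: cong_iotaDn.
have := QE (c k); rewrite Q0 horner0 !hornerE mulr_algr big_cons => ->.
by congr E; rewrite -addrA; congr (_ + _); rewrite addrC.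
Qed.

End Lift.

Theorem theorem6 (R : realType) (S : pred R[i]) (F : subFieldType S)
    (n N : nat) (p q : 'I_n -> nat) (f g : 'I_n -> F -> R[i])
    (n_gt0 : (0 < n)%N) (N_gt0 : (0 < N)%N)
    (p_gt0 : forall i, (0 < p i)%N) (q_gt0 : forall i, (0 < q i)%N)
    (p_incr : forall i j : 'I_n, (i < j)%N -> (p i < p j)%N)
    (pqN : forall i, (p i + q i)%N = N)
    (p_neq_q : forall i j, i != j -> p i != q j)
    (q_lt : forall i, (q i)%:R < N%:R / 2 :> R)
    (f_add : forall i x y, f i (x + y) = f i x + f i y)
    (g_add : forall i x y, g i (x + y) = g i x + g i y)
    (f_neq0 : forall i, exists x, f i x != 0)
    (g_neq0 : forall i, exists x, g i x != 0)
    (eq0 : forall x : F, \sum_(i < n) f i (x ^+ p i) * g i x ^+ q i = 0) :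
  exists l : nat, (0 < l)%N /\
  exists m P Q : 'I_n -> F^*m -> R[i],
    forall i : 'I_n,
      [/\ exponential (m i),
          generalized_polynomial l (P i),
          generalized_polynomial l (Q i)
        & forall x : F^*m,
            f i (val x) = P i x * m i x /\ g i (val x) = Q i x * m i x].
Proof.
(* [q i] lies below [N / 2], and [p j = N - q j] above it. *)
have p_gt_q i j : (q i < p j)%N.
  have half k : (q k * 2 < N)%N.
    by rewrite -(ltr_nat R) natrM -ltr_pdivlMr ?ltr0n.
  by have := half i; have := half j; have := pqN j; lia.
have pqE i j : (p i + q i = p j + q j)%N by rewrite !pqN.
have lift_neq0 (h : F -> R[i]) : (exists x, h x != 0) -> exists a, lift h a != 0.
  by move=> [x hx]; exists (iota R[i] x); rewrite lift_iota.
have [L HL] := @common_eigenvalue _ _ n p q (fun i => lift (f i))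
  (fun i => lift (g i)) p_gt_q q_gt0 p_incr pqE
  (fun i => lift_neq0 _ (f_neq0 i)) (fun i => lift_neq0 _ (g_neq0 i))
  (lift_equation p_gt0 f_add g_add eq0).
(* Raising the exponent to [L.+1] ensures a positive degree bound. *)
have eig k (x : F^*m) : exists lam,
    ann (lift (f k)) ((iota R[i] (val x) - lam%:A) ^+ L.+1) /\
    ann (lift (g k)) ((iota R[i] (val x) - lam%:A) ^+ L.+1).
  have [lam [fl gl]] := HL (iota R[i] (val x)) k.
  by exists lam; split; [apply: annX_leq fl|apply: annX_leq gl].
have [m Hm] := all_tag (fun k => choice (eig k)).
exists L.+1; split=> //.
exists m, (fun i x => f i (val x) / m i x), (fun i x => g i (val x) / m i x) => k.
have iotaMval (h : F -> R[i]) (x y : F^*m) : cong (lift h)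
    (iota R[i] (val (x * y)%g)) (iota R[i] (val x) * iota R[i] (val y)).
  by rewrite -iotaM; exact: cong_refl.
have gen (h : F -> R[i]) : (exists x, h x != 0) ->
    (forall x : F^*m, ann (lift h) ((iota R[i] (val x) - (m k x)%:A) ^+ L.+1)) ->
    [/\ exponential (m k),
        generalized_polynomial L.+1 (fun x : F^*m => h (val x) / m k x)
      & forall x, m k x != 0].
  move=> /lift_neq0 h0 hm; split.
  - exact: (eigenvalue_exponential h0 (iotaMval h) hm).
  - have -> : (fun x : F^*m => h (val x) / m k x)
        = (fun x => lift h (iota R[i] (val x)) / m k x).
      by apply/funext => x; rewrite lift_iota.
    exact: (eigenvalue_generalized_polynomial h0 (cong_iota1 h) (iotaMval h) hm).
  - exact: (eigenvalue_neq0 h0 (cong_iota1 h) (iotaMval h) hm).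
have [expm Pf m0] := gen (f k) (f_neq0 k) (fun x => (Hm k x).1).
have [_ Qg _] := gen (g k) (g_neq0 k) (fun x => (Hm k x).2).
by split=> // x; rewrite !divfK.
Qed.
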